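(* Consider the Diophantine equation $$F_{n_1}F_{n_2}F_{n_3}\cdots F_{n_k} - 1 = L_m^2$$ in integers $m\geq 0$, $k\geq 1$, and $0\leq n_1 \leq n_2 \leq \cdots \leq n_k$. For a given $m\ge 0$, it has a solution if and only if $m=1$ or $m$ is even. Moreover, the nontrivial solutions are exactly those given by $$F_3-1 = L_1^2,\quad F_5-1 = L_0^2,\quad F_3F_5-1 = L_2^2, \quad F_3F_5F_5-1 = L_4^2,$$ together with the infinite family $F_5F_{m-1}F_{m+1}-1 = L_m^2$ for every even number $m\geq 6$.
   Context: $(F_n)_{n\ge 0}$ is the Fibonacci sequence: $F_0=0$, $F_1=1$, $F_n=F_{n-1}+F_{n-2}$ for $n\ge 2$. $(L_n)_{n\ge 0}$ is the Lucas sequence: $L_0=2$, $L_1=1$, $L_n=L_{n-1}+L_{n-2}$ for $n\ge 2$. A solution is a tuple $(m,k,n_1,\dots,n_k)$; the indices $n_i$ need not be distinct, and each displayed product, with factors sorted by index, specifies a tuple. A solution is called nontrivial if either $k=1$, or $k\geq 2$ and $n_1\geq 3$. *)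

(* Defs.v *)
From mathcomp Require Import all_boot all_order all_algebra.

Set Implicit Arguments.
Unset Strict Implicit.
Unset Printing Implicit Defensive.

Import GRing.Theory Num.Theory.

Fixpoint fib (n : nat) : nat :=
  if n is n1.+1 then
    if n1 is n2.+1 then fib n1 + fib n2 else 1
  else 0.

Fixpoint lucas (n : nat) : nat :=
  if n is n1.+1 then
    if n1 is n2.+1 then lucas n1 + lucas n2 else 1
  else 2.

(** The solution (m, k, n_1, ..., n_k) is encoded by [m] and the sequence
    [ns = [:: n_1; ...; n_k]], so that [k = size ns]. *)
Definition is_solution (m : nat) (ns : seq nat) : Prop :=
  [/\ 0 < size ns,
      sorted leq ns
    & (\prod_(i <- ns) (fib i)%:Z - 1 = (lucas m)%:Z ^+ 2)%R].

(** [head 0 ns] is n_1; the default value 0 is irrelevant when k >= 1. *)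
Definition nontrivial (ns : seq nat) : Prop :=
  size ns = 1 \/ (2 <= size ns /\ 3 <= head 0 ns).

(* Main.v *)
Require Import Defs.
From mathcomp Require Import all_boot all_order all_algebra.
From mathcomp Require Import zify ring.

(** For odd [m], L_m^2 + 1 = F_{3m} / F_m is coprime to F_m, so every index of
    a factorization divides 3m and is coprime to m, hence equals 3; and 4 does
    not divide L_m^2 + 1.

    For even [m], L_m^2 + 1 = 5 F_a F_b with a = m - 1 and b = m + 1, and a size
    estimate shows that each index divides a, divides b, or equals 5. It remains
    to see that a itself (and likewise b) occurs. Otherwise all the indices
    dividing a are at most a/3. For a suitable prime q dividing a (usually the
    largest one), at most one index n fails to divide a/q, because F_q has a
    prime factor that does not divide 5a. As F_a / F_{a/q} is congruent to q or
    -q modulo F_{a/q}^2, it then divides q F_n, so F_a <= q F_{a/q} F_n, which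
    is too small. This replaces Carmichael's primitive divisor theorem. *)

Set Implicit Arguments.
Unset Strict Implicit.
Unset Printing Implicit Defensive.

Import GRing.Theory.

(** * Addition law, growth and gcds of Fibonacci numbers *)

Lemma fibSS n : fib n.+2 = fib n.+1 + fib n.
Proof. by []. Qed.

Lemma fibD m n : fib (m + n).+1 = fib m.+1 * fib n.+1 + fib m * fib n.
Proof.
elim: m n => [|m IH] n; first by rewrite mul1n mul0n addn0.
by rewrite addSnnS IH !fibSS; lia.
Qed.

(** Cassini's identity with F_{n-1} eliminated; the split by parity avoids the sign (-1)^n in
    [nat]. *)
Lemma cassini n :
  if odd n then fib n.+1 ^ 2 + 1 = fib n.+1 * fib n + fib n ^ 2
  else fib n.+1 ^ 2 = fib n.+1 * fib n + fib n ^ 2 + 1.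
Proof.
elim: n => // n; rewrite oddS fibSS; case: (odd n) => /=; nia.
Qed.

Lemma fib_gt0 n : 0 < n -> 0 < fib n.
Proof. by case: n => // n _; elim: n => // n IH; rewrite fibSS ltn_addr. Qed.

Lemma leq_fibS n : fib n <= fib n.+1.
Proof. by case: n => // n; rewrite fibSS leq_addr. Qed.

Lemma leq_fib m n : m <= n -> fib m <= fib n.
Proof.
move/subnKC <-; elim: (n - m) => [|k IH]; first by rewrite addn0.
by rewrite addnS (leq_trans IH) ?leq_fibS.
Qed.

Lemma ltn_fib m n : 1 < m -> m < n -> fib m < fib n.
Proof.
case: m => [//|[//|m]] _ lt_mn; apply: (leq_trans _ (leq_fib lt_mn)).
by rewrite [fib _.+3]fibSS -[ltnLHS]addn0 ltn_add2l fib_gt0.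
Qed.

Lemma fib_inj m n : 1 < m -> 1 < n -> fib m = fib n -> m = n.
Proof.
move=> m1 n1 E; case: (ltngtP m n) => // [/(ltn_fib m1)|/(ltn_fib n1)];
  by rewrite E ltnn.
Qed.

Lemma coprime_fibS n : coprime (fib n) (fib n.+1).
Proof.
elim: n => // n IH; rewrite fibSS coprime_sym.
by rewrite /coprime gcdnC gcdnDl gcdnC.
Qed.

(** Modulo F_m the addition law gives F_{m+n} = F_{m+1} F_n, and F_{m+1} is coprime to F_m. This is
    the step of Euclid's algorithm on the indices. *)
Lemma gcdn_fibD m n : gcdn (fib m) (fib (m + n)) = gcdn (fib m) (fib n).
Proof.
case: n => [|n]; first by rewrite addn0 gcdnn gcdn0.
by rewrite addnS fibD addnC [fib m * _]mulnC gcdnMDl Gauss_gcdr ?coprime_fibS.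
Qed.

Lemma gcdn_fib m n : gcdn (fib m) (fib n) = fib (gcdn m n).
Proof.
elim/ltn_ind: {m n}(m + n) {-2}m {-2}n (erefl (m + n)) => N IHN m n defN.
wlog le_mn : m n defN / m <= n => [gen|].
  have [le_mn|/ltnW le_nm] := leqP m n; first exact: gen.
  by rewrite gcdnC gen 1?addnC // gcdnC.
case: m => [|m] in defN le_mn *; first by rewrite !gcd0n.
rewrite -{1}(subnKC le_mn) gcdn_fibD (IHN (m.+1 + (n - m.+1))) //; last by lia.
by rewrite -gcdnDr subnK.
Qed.

Lemma dvdn_fib m n : m %| n -> fib m %| fib n.
Proof. by move=> /gcdn_idPl E; apply/gcdn_idPl; rewrite gcdn_fib E. Qed.

Lemma dvdn_fibE m n : 2 < m -> (fib m %| fib n) = (m %| n).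
Proof.
move=> m2; apply/idP/idP; last exact: dvdn_fib.
move=> /gcdn_idPl; rewrite gcdn_fib => E; apply/gcdn_idPl.
have [g1|g1] := ltnP 1 (gcdn m n); first by apply: fib_inj => //; apply: ltnW.
by have := leq_fib g1; rewrite E leqNgt (ltn_fib (isT : 1 < 2) m2).
Qed.

Lemma leq_fibM m n : fib m.+1 * fib n.+1 <= fib (m + n).+1.
Proof. by rewrite fibD leq_addr. Qed.

(** * The quotient F_{rt} / F_r modulo F_r^2 *)

(** Cayley-Hamilton for the 2r-th power of the Fibonacci matrix, which has trace 5 F_r^2 - 2 for odd
    r and determinant 1 ([tr] and [det] in the proof). *)
Lemma fib_addDouble r n : odd r ->
  ((fib (n + r.*2 + r.*2))%:Z = (5 * (fib r)%:Z ^+ 2 - 2) * (fib (n + r.*2))%:Z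
     - (fib n)%:Z)%R.
Proof.
case: r => // s odd_s.
have := cassini s.+1; rewrite odd_s fibSS => C.
have e1 m : fib (m + s.+1.*2) =
    fib m.+1 * fib s.+1.*2 + fib m * fib (s + s).+1.
  have d : s.+1.*2 = (s + s).+2 by rewrite doubleS -addnn.
  by rewrite d addnS fibD.
have e2 : fib (n + s.+1.*2).+1 =
    fib n.+1 * fib s.+1.*2.+1 + fib n * fib s.+1.*2.
  exact: fibD.
have e3 : fib s.+1.*2 = fib s.+1 * (fib s.+1 + fib s) + fib s * fib s.+1.
  by rewrite -fibSS -fibD; congr fib; lia.
have e4 : fib s.+1.*2.+1 = (fib s.+1 + fib s) ^ 2 + fib s.+1 ^ 2.
  by rewrite -addnn fibD fibSS; lia.
have e5 : fib (s + s).+1 = fib s.+1 ^ 2 + fib s ^ 2 by rewrite fibD; lia.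
have C' : fib s.+1 ^ 2 = fib s * (fib s.+1 + fib s) + 1 by nia.
have tr : ((fib (s + s).+1)%:Z + (fib s.+1.*2.+1)%:Z
            = 5 * (fib s.+1)%:Z ^+ 2 - 2)%R by nia.
have det : ((fib (s + s).+1)%:Z * (fib s.+1.*2.+1)%:Z
             - (fib s.+1.*2)%:Z ^+ 2 = 1)%R by rewrite e3 e4 e5; nia.
rewrite -tr -[X in (_ - X)%R]GRing.mulr1 -det e1 e2 e1; ring.
Qed.

(** For the quotients modulo F_r^2, the recurrence of [fib_addDouble] becomes u_{i+2} = -2 u_{i+1} -
    u_i, solved by (-1)^i (2i + 1). It has order two, so the induction carries two consecutive
    cases. *)
Lemma fib_quotient_mod r i : odd r -> exists x y : int,
  ((fib (r * i.*2.+1))%:Z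
     = (fib r)%:Z * ((-1) ^+ i * i.*2.+1%:Z + (fib r)%:Z ^+ 2 * x))%R /\
  ((fib (r * i.+1.*2.+1))%:Z
     = (fib r)%:Z * ((-1) ^+ i.+1 * i.+1.*2.+1%:Z + (fib r)%:Z ^+ 2 * y))%R.
Proof.
move=> odd_r.
have step j : r * j.+1.*2.+1 = r * j.*2.+1 + r.*2 by lia.
elim: i => [|i [x [y [Ex Ey]]]].
  (* The witness 5 comes from F_{3r} = F_r (5 F_r^2 - 3). *)
  exists 0%R, 5%R; split; first by rewrite muln1 expr0 mulr0 addr0 !mulr1.
  case: r odd_r {step} => // s odd_s.
  have := cassini s.+1; rewrite odd_s fibSS => C.
  have -> : s.+1 * 1.*2.+1 = (s.+1 + (s.+1 + s)).+1 by lia.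
  have C' : fib s.+1 ^ 2 = fib s * (fib s.+1 + fib s) + 1 by nia.
  rewrite fibD fibD [s.+1 + s]addSn fibD !fibSS; nia.
exists y, (-5 * (-1) ^+ i * i.+1.*2.+1%:Z - 2 * y
             + 5 * (fib r)%:Z ^+ 2 * y - x)%R.
split => //.
rewrite [r * i.+2.*2.+1]step [r * i.+1.*2.+1]step fib_addDouble // -step Ey Ex.
rewrite !GRing.exprS.
have -> : (i.+2.*2.+1%:Z = i.*2.+1%:Z + 4)%R by lia.
have -> : (i.+1.*2.+1%:Z = i.*2.+1%:Z + 2)%R by lia.
ring.
Qed.

(* Up to sign, [Q] is congruent to [t] modulo F_r^2. *)
Lemma fib_quotient r t : odd r -> odd t ->
  exists2 Q, fib (r * t) = fib r * Q
           & forall d, d %| fib r ^ 2 -> (d %| Q) = (d %| t).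
Proof.
move=> odd_r odd_t.
have r0 : 0 < fib r by apply: fib_gt0; case: r odd_r.
have [x [_ [Ex _]]] := fib_quotient_mod t./2 odd_r.
have tE : t./2.*2.+1 = t by rewrite -[RHS](odd_double_half t) odd_t.
rewrite tE in Ex.
have /dvdnP[Q EQ] : fib r %| fib (r * t) by exact/dvdn_fib/dvdn_mulr.
exists Q => [|d d_r]; first by rewrite EQ mulnC.
have QE : (Q%:Z = (-1) ^+ t./2 * t%:Z + (fib r)%:Z ^+ 2 * x)%R by nia.
have -> : (d %| Q) = (d%:Z %| Q%:Z)%Z by [].
have d_rx : ((fib r)%:Z ^+ 2 * x \in dvdz d%:Z)%R by exact: dvdz_mulr.
rewrite QE -[LHS]/(_ \in dvdz _) rpredDr //.
by rewrite -[LHS]/(_ %| _)%Z dvdzE abszMsign.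
Qed.

(** * Fibonacci numbers modulo primes *)

(** The ring is arbitrary because [x] will be a 2 by 2 matrix over ['F_p]. *)
Lemma golden_exp (R : nzRingType) (x : R) n : (x ^+ 2 = x + 1 ->
  x ^+ n.+1 = x *+ fib n.+1 + 1 *+ fib n)%R.
Proof.
move=> x2; elim: n => [|n IH]; first by rewrite addr0.
rewrite exprSr IH mulrDl !mulrnAl -expr2 x2 mul1r fibSS !mulrnDr mulrnDl.
by rewrite addrAC.
Qed.

(* With M^2 = M + 1 one has M^p = F_p M + F_{p-1}, while N = 2M - 1 satisfies
   N^2 = 5; raising 2M = N + 1 to the p-th power in characteristic p gives
   F_p = 5^((p-1)/2) in 'F_p. *)
Lemma fib_prime_sqr p : prime p -> odd p -> p != 5 -> fib p ^ 2 = 1 %[mod p].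
Proof.
move=> p_pr p_odd p5.
have ch : p \in [pchar 'F_p]%R by exact: pchar_Fp.
have chM : p \in [pchar 'M['F_p]_2]%R by rewrite pchar_lalg.
pose M : 'M['F_p]_2 := (\matrix_(i, j) ((i == 0) || (j == 0))%:R)%R.
have M2 : (M ^+ 2 = M + 1)%R.
  apply/matrixP=> i j; rewrite expr2 -[(M * M)%R]/(M *m M)%R.
  rewrite !mxE !big_ord_recl big_ord0 !mxE.
  case: i j => [[|[|//]] ?] [[|[|//]] ?] /=;
    by rewrite !(mulr1, mulr0, addr0, add0r).
pose N := (M *+ 2 - 1)%R.
have N2 : (N ^+ 2 = 5%:R)%R.
  rewrite /N sqrrB1 exprMn_n M2 -mulrnA mulrnDl.
  by rewrite [(M *+ _ + _)%R]addrC addrK -mulrSr.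
have pE : p = p.-1.+1 by rewrite prednK ?prime_gt0.
have hE : p = p./2.*2.+1 by rewrite -[LHS](odd_double_half p) p_odd.
have Np : (N ^+ p = N *+ 5 ^ p./2)%R.
  rewrite (congr1 (GRing.exp N) hE) exprSr -mul2n exprM N2.
  by rewrite -natrX mulr_natl.
have Mp : (M ^+ p = M *+ fib p + 1 *+ fib p.-1)%R.
  by have := golden_exp p.-1 M2; rewrite -pE.
have frob : (M ^+ p *+ 2 = N ^+ p + 1)%R.
  rewrite -(pFrobenius_autE chM) -pFrobenius_autMn.
  rewrite -[in LHS](subrK 1%R (M *+ 2)%R) -/N.
  rewrite -!(pFrobenius_autE chM) pFrobenius_autD_comm ?pFrobenius_aut1 //.
  exact: commr1.
have fib2 : ((fib p)%:R *+ 2 = 5%:R ^+ p./2 *+ 2 :> 'F_p)%R.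
  rewrite Np Mp /N in frob.
  (* An off-diagonal entry is compared: there the identity matrix vanishes and [M] has entry 1. *)
  have := congr1 (fun A : 'M_2 => A ord0 ord_max) frob.
  rewrite !(mulmxnE, mxE) /= !mul0rn !addr0 oppr0 addr0.
  by move->; rewrite -natrX mulrnAC.
have unit_Fp k : prime k -> k != p -> (k%:R != 0 :> 'F_p)%R.
  move=> k_pr kp; rewrite -(dvdn_pcharf ch).
  by rewrite dvdn_prime2 // eq_sym.
have p2 : 2 != p by apply: contraTneq p_odd => <-.
have fibE : ((fib p)%:R = 5%:R ^+ p./2 :> 'F_p)%R.
  apply: (mulIf (unit_Fp 2 isT p2)); rewrite !mulr_natr; exact: fib2.
have : ((fib p ^ 2)%:R = 1%:R :> 'F_p)%R.
  (* The square is 5^(p-1); multiplied by 5 it becomes 5^p, which is 5 by Fermat. *)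
  rewrite natrX fibE -exprM muln2.
  apply: (mulIf (unit_Fp 5 isT _)); first by rewrite eq_sym.
  rewrite -exprSr -hE mul1r.
  by rewrite -(pFrobenius_autE ch) pFrobenius_aut_nat.
by move/(congr1 (@nat_of_ord _)); rewrite !val_Fp_nat.
Qed.

Lemma coprime_fib m n : coprime m n -> coprime (fib m) (fib n).
Proof. by rewrite /coprime gcdn_fib => /eqP ->. Qed.

Lemma dvdn_gcdr_mul k c x : k %| c * x -> k %| c * gcdn k x.
Proof. by move=> k_cx; rewrite muln_gcdr dvdn_gcd dvdn_mull. Qed.

Lemma fib_gt1 n : 2 < n -> 1 < fib n.
Proof. exact: (@ltn_fib 2). Qed.

(** By [fib_prime_sqr] and Cassini, p divides F_{p-1} F_{p+1}. If p < q, then p - 1 and p + 1 are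
    coprime to q (parity rules out p + 1 = q), so p cannot divide F_q as well. The case p = q fails
    since F_p^2 is 1 modulo p. *)
Lemma ltn_fib_prime_divisor q p : prime q -> odd q -> q != 5 ->
  prime p -> odd p -> p %| fib q -> q < p.
Proof.
move=> q_pr q_odd q5 p_pr p_odd p_q.
have notcop j : coprime q j -> ~~ (p %| fib j).
  move=> /coprime_fib cop; apply/negP => p_j.
  have : p %| gcdn (fib q) (fib j) by rewrite dvdn_gcd p_q.
  by rewrite (eqP cop) dvdn1 => /eqP p1; rewrite p1 in p_pr.
have p5 : p != 5.
  apply: contraTneq (notcop 5 _) => [->//|].
  by rewrite prime_coprime // dvdn_prime2.
have sqr1 := fib_prime_sqr p_pr p_odd p5.
have dvd1 : ~~ (p %| 1) by rewrite dvdn1; apply: contraTneq p_pr => ->.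
have pE : p = p.-1.+1 by rewrite prednK ?prime_gt0.
have := cassini p; rewrite p_odd => C.
have fibpE : fib p.+1 = fib p + fib p.-1 by rewrite pE fibSS -pE.
have prodE : fib p.-1 * fib p.+1 + 1 = fib p ^ 2 by nia.
have : p %| fib p.-1 * fib p.+1.
  have : p %| fib p ^ 2 - 1.
    by rewrite -eqn_mod_dvd ?sqr1 // expn_gt0 fib_gt0 ?prime_gt0.
  by rewrite -prodE addnK.
rewrite Euclid_dvdM // ltnNge => dvd_prod; apply/negP => le_pq.
have [p_eq_q|p_neq_q] := eqVneq p q.
  have : p %| fib p ^ 2 by rewrite dvdn_exp // {2}p_eq_q.
  by rewrite /dvdn sqr1 -/(dvdn p 1) (negbTE dvd1).
have lt_pq : p < q by rewrite ltn_neqAle p_neq_q.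
have copj j : 0 < j -> j < q -> coprime q j.
  by move=> j0 jq; rewrite prime_coprime // gtnNdvd.
have p_gt1 := prime_gt1 p_pr.
have lt_p1q : p.+1 < q.
  rewrite ltn_neqAle lt_pq andbT; apply: contraTneq q_odd => <-.
  by rewrite /= p_odd.
case/orP: dvd_prod; apply/negP/notcop/copj => //; lia.
Qed.

(** * Forcing the index a to occur in a product *)

Lemma prime_dvd_prod_fib l s : prime l -> l %| \prod_(n <- s) fib n ->
  exists2 n, n \in s & l %| fib n.
Proof.
move=> l_pr; elim: s => [|n s IH].
  by rewrite big_nil dvdn1 => /eqP l1; rewrite l1 in l_pr.
rewrite big_cons Euclid_dvdM // => /orP[l_n|/IH[k ks l_k]].
  by exists n; rewrite ?mem_head.
by exists k; rewrite // in_cons ks orbT.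
Qed.

Lemma coprimePn_prime m n : 0 < m -> ~~ coprime m n ->
  exists l, [/\ prime l, l %| m & l %| n].
Proof.
move=> m0 ncop; exists (pdiv (gcdn m n)).
have g1 : 1 < gcdn m n by rewrite ltn_neqAle eq_sym ncop gcdn_gt0 m0.
split; first exact: pdiv_prime.
  exact: dvdn_trans (pdiv_dvd _) (dvdn_gcdl _ _).
exact: dvdn_trans (pdiv_dvd _) (dvdn_gcdr _ _).
Qed.

(** Applied with G = F_{a/q} and Q = F_a / G. A prime common to Q and X divides G, hence divides q,
    so only q can obstruct coprimality. When q divides G, it divides Q exactly once, and Q / q is
    coprime to X. *)
Lemma quotient_dvdn q G Q X Y : prime q -> 0 < Q ->
  (forall d, d %| G ^ 2 -> (d %| Q) = (d %| q)) ->
  (forall l, prime l -> l %| X -> l %| G) ->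
  Q %| Y * X -> Q %| q * Y.
Proof.
move=> q_pr Q0 dvdQ primeX Q_YX.
have key Q' : Q' %| Q -> ~~ (q %| gcdn Q' G) -> Q' %| Y.
  move=> Q'Q ndvd.
  have Q'0 := dvdn_gt0 Q0 Q'Q.
  suff cop : coprime Q' X by rewrite -(Gauss_dvdl _ cop) (dvdn_trans Q'Q).
  apply: contraR ndvd => /(coprimePn_prime Q'0)[l [l_pr l_Q' l_X]].
  have l_G := primeX l l_pr l_X.
  have : l %| q by rewrite -dvdQ ?dvdn_exp //; exact: dvdn_trans Q'Q.
  by rewrite dvdn_prime2 // => /eqP <-; rewrite dvdn_gcd l_Q' l_G.
have [q_G|q_G] := boolP (q %| G); last first.
  apply/dvdn_mull/(key _ (dvdnn Q)).
  by rewrite dvdn_gcd (negbTE q_G) andbF.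
have /dvdnP[Q' QE] : q %| Q by rewrite dvdQ // dvdn_exp.
rewrite QE mulnC dvdn_pmul2l ?prime_gt0 //; apply: key.
  by rewrite QE dvdn_mulr.
rewrite dvdn_gcd q_G andbT; apply/negP => q_Q'.
(* As q^2 divides G^2, [dvdQ] also decides whether q^2 divides Q. *)
have : q * q %| q by rewrite -dvdQ ?QE ?dvdn_mul // -mulnn dvdn_mul.
move/dvdn_leq; rewrite prime_gt0 // => /(_ isT).
by have := prime_gt1 q_pr; nia.
Qed.

(** Otherwise F_q^2 divides 5 F_a, so p divides F_a / F_q and hence, by [fib_quotient], the cofactor
    a / q. *)
Lemma multiple_unique a q p n k : odd a -> odd q -> q %| a ->
  prime p -> p %| fib q -> p != 5 -> ~~ (p %| a) ->
  q %| n -> q %| k -> ~~ (fib n * fib k %| 5 * fib a).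
Proof.
move=> a_odd q_odd /dvdnP[t aE] p_pr p_q p5 p_a q_n q_k; apply/negP => dvd.
move: a_odd; rewrite aE mulnC oddM q_odd /= => t_odd.
have [Q QE dvdQ] := fib_quotient q_odd t_odd.
have q0 : 0 < fib q by apply: fib_gt0; case: q q_odd {aE p_q q_n q_k QE dvdQ}.
have : fib q * fib q %| fib q * (5 * Q).
  apply: dvdn_trans (dvdn_mul (dvdn_fib q_n) (dvdn_fib q_k)) _.
  by apply: dvdn_trans dvd _; rewrite aE [t * q]mulnC QE mulnCA.
rewrite dvdn_pmul2l // => /(dvdn_trans p_q).
rewrite Euclid_dvdM // dvdn_prime2 // (negbTE p5) /= dvdQ ?dvdn_exp //.
by move=> p_t; rewrite aE dvdn_mulr in p_a.
Qed.

Lemma leq_fib_index n : n <= fib n.+1.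
Proof.
elim: n => // n IH; rewrite fibSS; case: n IH => // n IH.
by have := @fib_gt0 n.+1 isT; lia.
Qed.

(** Yields the final size contradiction: with h = [a %/ 3], the left side bounds F_{a/q} (q F_n), as
    a/q, q and n are all at most h. *)
Lemma fib_triple_gt h : 0 < h -> fib h * (h * fib h) < fib (3 * h).
Proof.
case: h => // k _.
have -> : 3 * k.+1 = (k.+1 + (k + k).+1).+1 by lia.
rewrite fibD.
have := leq_fib_index k.+1; have := leq_fibM k k.
have := leq_fibS (k + k).+1; have := @fib_gt0 k.+1 isT.
have := @fib_gt0 (k + k).+1 isT.
by nia.
Qed.

Lemma gt2_odd_neq1 n : odd n -> n != 1 -> 2 < n.
Proof. by case: n => [|[|[|n]]]. Qed.

Lemma odd_dvd n a : odd a -> n %| a -> odd n.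
Proof. by move=> a_odd /dvdnP[t E]; move: a_odd; rewrite E oddM => /andP[]. Qed.

(** If the largest prime factor of a is not 5, it serves as q: a prime factor of F_q is 2 or exceeds
    q, so it does not divide a. Otherwise q is 3 if 3 divides a, as F_3 = 2, and 5 if not. *)
Lemma exists_separating_prime a s : odd a -> 2 < a ->
  \prod_(n <- s) fib n %| 5 * fib a ->
  {in s, forall n, n %| a /\ n < a} ->
  exists q, [/\ prime q, q %| a & size [seq n <- s | ~~ (n %| a %/ q)] <= 1].
Proof.
move=> a_odd a2 dvd5 dvd_s.
have [a0 a1] : 0 < a /\ 1 < a by lia.
have notdvd q n : prime q -> q %| a -> n \in s -> ~~ (n %| a %/ q) -> q %| n.
  move=> q_pr q_a ns; apply: contraR => ndvd.
  have cop : coprime n q by rewrite coprime_sym prime_coprime.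
  by have [+ _] := dvd_s n ns; rewrite -{1}(divnK q_a) Gauss_dvdl.
have few q p : prime q -> q %| a -> prime p -> p %| fib q -> p != 5 ->
    ~~ (p %| a) -> size [seq n <- s | ~~ (n %| a %/ q)] <= 1.
  move=> q_pr q_a p_pr p_q p5 p_a.
  have q_odd := odd_dvd a_odd q_a.
  have all_q : {in [seq n <- s | ~~ (n %| a %/ q)], forall n, q %| n}.
    by move=> n; rewrite mem_filter => /andP[nd ns]; exact: notdvd nd.
  have := dvd5; rewrite (bigID (fun n => ~~ (n %| a %/ q))) /= -big_filter.
  case: [seq _ <- s | _] all_q => [|n [|k s']] // all_q.
  rewrite !big_cons => dvdnk.
  have q_n := all_q n (mem_head _ _).
  have q_k : q %| k by apply: all_q; rewrite !inE eqxx orbT.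
  case/negP: (multiple_unique a_odd q_odd q_a p_pr p_q p5 p_a q_n q_k).
  by apply: dvdn_trans dvdnk; rewrite mulnA -mulnA dvdn_mulr.
have [q5|q5] := eqVneq (max_pdiv a) 5; last first.
  set q := max_pdiv a in q5.
  have q_pr : prime q by exact: max_pdiv_prime.
  have q_a : q %| a by exact: max_pdiv_dvd.
  have q_odd := odd_dvd a_odd q_a.
  have q2 : 2 < q by rewrite gt2_odd_neq1 //; apply: contraTneq q_pr => ->.
  exists q; split => //.
  pose p := pdiv (fib q).
  have p_pr : prime p by rewrite pdiv_prime ?fib_gt1.
  have p_q : p %| fib q by exact: pdiv_dvd.
  apply: (few q p) => //.
    apply: contra_neq q5 => p5; move: p_q; rewrite p5.
    by rewrite -[X in X %| _]/(fib 5) dvdn_fibE // dvdn_prime2 // => /eqP.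
  have [p_odd|p_even] := boolP (odd p); last first.
    by apply: contra p_even; exact: odd_dvd.
  have lt_qp := ltn_fib_prime_divisor q_pr q_odd q5 p_pr p_odd p_q.
  apply/negP => p_a; have := max_pdiv_max (_ : p \in \pi(a)).
  by rewrite mem_primes p_pr a0 p_a => /(_ isT); rewrite leqNgt lt_qp.
have [three_a|three_a] := boolP (3 %| a).
  exists 3; split=> //; apply: (few 3 2) => //.
  by rewrite dvdn2 a_odd.
have five_a : 5 %| a by rewrite -q5 max_pdiv_dvd.
(* Now a is a power of 5, so all its proper divisors divide a/5. *)
exists 5; split=> //.
have /p_natP[k aE] : 5.-nat a.
  apply/pnatP => // l l_pr l_a.
  have : l <= 5 by rewrite -q5 max_pdiv_max // mem_primes l_pr a0 l_a.
  case: l l_pr l_a => [|[|[|[|[|[|l]]]]]] //;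
    by rewrite ?dvdn2 ?a_odd // (negbTE three_a).
rewrite size_filter leqW // leqNgt -has_count; apply/hasPn => n ns.
have [+ lt_na] := dvd_s n ns; rewrite negbK.
case: k aE => [|k] aE; first by rewrite aE in a1.
rewrite aE expnS mulKn // -expnS => /(dvdn_pfactor _ _ (isT : prime 5))[j].
rewrite leq_eqVlt => /orP[/eqP -> nE|lt_jk ->]; last by rewrite dvdn_exp2l.
by rewrite nE aE ltnn in lt_na.
Qed.

(** The slack factor 5 is there because, when 5 divides a, the extra F_5 of the even case is counted
    in this product. *)
Lemma prod_fib_mem a s : odd a -> 2 < a ->
  {in s, forall n, 2 < n /\ n %| a} ->
  fib a %| \prod_(n <- s) fib n -> \prod_(n <- s) fib n %| 5 * fib a ->
  a \in s.
Proof.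
move=> a_odd a2 sP a_dvd dvd5; apply/negPn/negP => aNs.
have a0 : 0 < a by lia.
(* The cofactor of a proper divisor is odd and greater than 1, so at least 3. *)
have third d : d %| a -> d != a -> d <= a %/ 3.
  move=> d_a d_neq; rewrite leq_divRL // mulnC.
  have E := divnK d_a.
  have := odd_dvd a_odd (dvdn_div d_a); rewrite -{2}E => odd_t.
  rewrite leq_pmul2r ?(dvdn_gt0 a0) // gt2_odd_neq1 //.
  by apply: contra_neq d_neq => t1; rewrite -E t1 mul1n.
have lt_s : {in s, forall n, n %| a /\ n < a}.
  move=> n ns; have [n2 n_a] := sP n ns; split=> //.
  rewrite ltn_neqAle dvdn_leq // andbT.
  by apply: contraNneq aNs => <-.
have [q [q_pr q_a sz]] := exists_separating_prime a_odd a2 dvd5 lt_s.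
have q_odd := odd_dvd a_odd q_a.
have c_odd := odd_dvd a_odd (dvdn_div q_a).
have [Q QE dvdQ] := fib_quotient c_odd q_odd.
rewrite divnK // in QE.
have Q0 : 0 < Q by have := fib_gt0 a0; rewrite QE muln_gt0 => /andP[].
pose Y := \prod_(n <- s | ~~ (n %| a %/ q)) fib n.
pose X := \prod_(n <- s | n %| a %/ q) fib n.
have YX : \prod_(n <- s) fib n = Y * X.
  rewrite (bigID (fun n => ~~ (n %| a %/ q))) /=; congr (_ * _).
  by apply: eq_bigl => n; rewrite negbK.
have Q_qY : Q %| q * Y.
  apply: (quotient_dvdn (X := X) q_pr Q0 dvdQ).
    move=> l l_pr; rewrite /X -big_filter => /(prime_dvd_prod_fib l_pr)[n].
    by rewrite mem_filter => /andP[n_c _] /dvdn_trans; apply; exact: dvdn_fib.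
  by rewrite -YX; apply: dvdn_trans a_dvd; rewrite QE dvdn_mull.
have h0 : 0 < a %/ 3 by rewrite divn_gt0.
have Y0 : 0 < Y.
  have : 0 < 5 * fib a by rewrite muln_gt0 fib_gt0.
  by move/dvdn_gt0/(_ dvd5); rewrite YX muln_gt0 => /andP[].
have Yle : Y <= fib (a %/ 3).
  rewrite /Y -big_filter.
  have: {subset [seq n <- s | ~~ (n %| a %/ q)] <= s}.
    by move=> n; rewrite mem_filter => /andP[].
  case: [seq n <- s | _] sz => [|n [|]] // _ sub.
    by rewrite big_nil fib_gt0.
  rewrite big_seq1 leq_fib //.
  have [n_a /ltn_eqF n_lt] := lt_s n (sub n (mem_head _ _)).
  by apply: third => //; rewrite n_lt.
(* If a = q were prime, every index, being a divisor of a above 2, would equal a; and an index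
   exists because F_a > 1 divides the product. *)
have q_lt : q != a.
  apply/eqP => qa; have /(prime_dvd_prod_fib (pdiv_prime (fib_gt1 a2)))[n ns _]
    := dvdn_trans (pdiv_dvd (fib a)) a_dvd.
  have [n2 n_a] := sP n ns.
  move: n_a; rewrite -qa => /(prime_nt_dvdP q_pr) n_q.
  by rewrite -qa -n_q // in aNs; [rewrite ns in aNs | lia].
have c_lt : a %/ q != a.
  by rewrite neq_ltn ltn_Pdiv ?prime_gt1.
(* With h = [a %/ 3], the contradicting chain is F_{3h} <= F_a = F_{a/q} Q <= F_h (h F_h). *)
have := fib_triple_gt h0; apply/negP; rewrite -leqNgt.
have le_a : 3 * (a %/ 3) <= a by rewrite mulnC leq_divM.
apply: leq_trans (leq_fib le_a) _.
rewrite QE; apply: leq_mul; first exact/leq_fib/third/c_lt/dvdn_div.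
have qY0 : 0 < q * Y by rewrite muln_gt0 prime_gt0.
apply: leq_trans (dvdn_leq qY0 Q_qY) _.
by apply: leq_mul => //; exact: third.
Qed.

(** * Lucas numbers and the factorization of L_m^2 + 1 *)

Lemma lucasE n : lucas n.+1 = fib n.+1 + 2 * fib n.
Proof.
suff: lucas n.+1 = fib n.+1 + 2 * fib n /\ lucas n.+2 = fib n.+2 + 2 * fib n.+1.
  by case.
elim: n => // n [IH1 IH2]; split=> //.
by rewrite -[lucas n.+3]/(lucas n.+2 + lucas n.+1) IH1 IH2 !fibSS; lia.
Qed.

Lemma lucas_gt0 m : 0 < lucas m.
Proof. by case: m => // m; rewrite lucasE addn_gt0 fib_gt0. Qed.

Lemma lucas_sqr_even m : ~~ odd m -> 0 < m ->
  lucas m ^ 2 + 1 = 5 * (fib m.-1 * fib m.+1).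
Proof.
case: m => // m; rewrite oddS negbK lucasE fibSS => m_odd _.
by have := cassini m; rewrite m_odd /=; nia.
Qed.

(** Its use is that a common divisor of F_m and L_m^2 + 1 divides 3. *)
Lemma lucas_sqr_odd m : odd m -> lucas m ^ 2 + 4 = 5 * fib m ^ 2.
Proof.
case: m => // m; rewrite oddS lucasE => m_even.
by have := cassini m; rewrite (negbTE m_even); nia.
Qed.

(** For odd m, F_{3m} / F_m = L_{2m} - 1 and L_{2m} = L_m^2 + 2. *)
Lemma fib_triple_odd m : odd m -> fib (3 * m) = fib m * (lucas m ^ 2 + 1).
Proof.
case: m => // m m_odd.
have := cassini m; rewrite (negbTE (m_odd : ~~ odd m)) lucasE => C.
have -> : 3 * m.+1 = (m.+1 + (m.+1 + m)).+1 by lia.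
by rewrite fibD fibD [m.+1 + m]addSn fibD !fibSS; nia.
Qed.

(** * Products with indices above 2, and the case of odd m *)

Lemma prod_fib_dvd n s : n \in s -> fib n %| \prod_(k <- s) fib k.
Proof.
elim: s => // k s IH; rewrite in_cons big_cons => /orP[/eqP <-|/IH n_s].
  exact: dvdn_mulr.
exact: dvdn_mull.
Qed.

Lemma prod_fib_eq1 s : all (ltn 2) s -> \prod_(n <- s) fib n = 1 -> s = [::].
Proof.
case: s => // n s /andP[n2 _] E.
by have := prod_fib_dvd (mem_head n s); rewrite E dvdn1 => /eqP E1;
  have := fib_gt1 n2; rewrite E1.
Qed.

Lemma prod_fib_prime p s : all (ltn 2) s -> 2 < p -> prime (fib p) ->
  \prod_(n <- s) fib n = fib p -> s = [:: p].
Proof.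
case: s => [|n s] s2 p2 p_pr E; first by rewrite -E big_nil in p_pr.
have /andP[/= n2 s2'] := s2.
have n1 := fib_gt1 n2.
have fib_n : fib n = fib p.
  apply/eqP; rewrite -(dvdn_prime2 _ p_pr).
    by rewrite -E prod_fib_dvd ?mem_head.
  have : fib n %| fib p by rewrite -E prod_fib_dvd ?mem_head.
  move/primeP: (p_pr) => [_ H] /H/orP[/eqP n_eq|/eqP ->//].
  by rewrite n_eq in n1.
have -> : n = p by apply: fib_inj fib_n; lia.
congr (_ :: _); apply: prod_fib_eq1 => //.
move: E; rewrite big_cons fib_n => /eqP; rewrite -[X in _ == X]muln1 eqn_pmul2l.
  by move/eqP.
by rewrite -fib_n ltnW.
Qed.

Lemma solution_odd m s : odd m -> all (ltn 2) s ->
  \prod_(n <- s) fib n = lucas m ^ 2 + 1 -> m = 1 /\ s = [:: 3].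
Proof.
move=> m_odd s2 E.
(* A square is 0 or 1 modulo 3, and likewise modulo 4 below. *)
have not3 : ~~ (3 %| lucas m ^ 2 + 1).
  rewrite (divn_eq (lucas m) 3); apply/negP => /dvdnP[k].
  by case: (_ %% 3) (ltn_pmod (lucas m) (isT : 0 < 3)) => [|[|[|r]]] // _; lia.
have not4 : ~~ (4 %| lucas m ^ 2 + 1).
  rewrite (divn_eq (lucas m) 2); apply/negP => /dvdnP[k].
  by case: (_ %% 2) (ltn_pmod (lucas m) (isT : 0 < 2)) => [|[|r]] // _; lia.
have all3 : {in s, forall n, n = 3}.
  move=> n ns; have n2 : 2 < n := allP s2 n ns.
  have n_dvd : fib n %| lucas m ^ 2 + 1 by rewrite -E prod_fib_dvd.
  have n_3m : n %| 3 * m by rewrite -dvdn_fibE // fib_triple_odd // dvdn_mull.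
  have cop : coprime n m.
    have g_dvd : fib (gcdn n m) %| lucas m ^ 2 + 1.
      by apply: dvdn_trans n_dvd; apply/dvdn_fib/dvdn_gcdl.
    (* Adding 3 to L_m^2 + 1 gives 5 F_m^2, and F_{gcd(n,m)} divides both L_m^2 + 1 and F_m. *)
    have g_3 : fib (gcdn n m) %| 3.
      rewrite -(dvdn_addr 3 g_dvd) -addnA lucas_sqr_odd // dvdn_mull //.
      by rewrite dvdn_exp //; apply/dvdn_fib/dvdn_gcdr.
    have g_odd : odd (gcdn n m) by apply: odd_dvd m_odd (dvdn_gcdr _ _).
    apply/eqP; apply: contraNeq not3 => g1.
    have := fib_gt1 (gt2_odd_neq1 g_odd g1).
    have /primeP[_ /(_ _ g_3)] : prime 3 by [].
    by case/orP=> /eqP g_eq; rewrite -?g_eq // g_eq.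
  rewrite Gauss_dvdl // in n_3m.
  by apply/eqP; rewrite eqn_leq n2 dvdn_leq.
(* The empty product would force L_m = 0, and two indices equal to 3 would contribute a factor 4. *)
case: s E s2 all3 => [|n [|k s]] E _ all3.
- by rewrite big_nil in E; have := lucas_gt0 m; nia.
- have n3 := all3 n (mem_head _ _); rewrite n3 big_seq1 in E *.
  split=> //; have lucas1 : lucas m = 1 by rewrite -[fib 3]/2 in E; nia.
  case: m m_odd lucas1 {E not3 not4} => [|[|m]] //.
  rewrite lucasE => _.
  by have := @fib_gt0 m.+1 isT; have := @fib_gt0 m.+2 isT; lia.
- case/negP: not4; rewrite -E !big_cons mulnA (all3 n) ?mem_head // (all3 k).
    exact: dvdn_mulr.
  by rewrite !inE eqxx orbT.
Qed.

(** * The case of even m *)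

(** With d = gcd(n, a) and e = gcd(n, b), F_n divides 5 F_d F_e <= F_{d+e+3}, so n <= d + e + 3,
    while d e divides n. If d and e both exceed 1, they are distinct odd numbers and d e is already
    too large. *)
Lemma dvdn_5fibM n a b : odd a -> odd b -> coprime a b -> 2 < n ->
  fib n %| 5 * (fib a * fib b) -> [\/ n %| a, n %| b | n = 5].
Proof.
move=> a_odd b_odd cop n2 n_dvd.
pose d := gcdn n a; pose e := gcdn n b.
have n_de : fib n %| fib 5 * (fib d * fib e).
  rewrite -!gcdn_fib mulnA mulnAC; apply: dvdn_gcdr_mul.
  rewrite mulnAC; apply: dvdn_gcdr_mul.
  by rewrite -mulnA.
have d_odd : odd d by exact: odd_dvd a_odd (dvdn_gcdr _ _).
have e_odd : odd e by exact: odd_dvd b_odd (dvdn_gcdr _ _).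
have cop_de : coprime d e.
  by apply: coprime_dvdl (dvdn_gcdr _ _) (coprime_dvdr (dvdn_gcdr _ _) cop).
have /dvdnP[t nE] : d * e %| n by rewrite Gauss_dvd // !dvdn_gcdl.
have d0 : 0 < d by case: (d) d_odd.
have e0 : 0 < e by case: (e) e_odd.
have fib_de : fib 5 * (fib d * fib e) <= fib (d + e + 3).
  rewrite -(prednK d0) -(prednK e0).
  apply: leq_trans (leq_mul (leqnn _) (leq_fibM _ _)) _.
  by apply: leq_trans (leq_fibM 4 _) (leq_fib _); lia.
have le_n : n <= d + e + 3.
  rewrite leqNgt; apply/negP => lt_n.
  have pos : 0 < fib 5 * (fib d * fib e) by rewrite !muln_gt0 !fib_gt0.
  have := leq_trans (dvdn_leq pos n_de) fib_de.
  by rewrite leqNgt ltn_fib //; lia.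
(* Here x is the one of d and e that remains when the other is 1. The bound leaves n = 3, 4, 5 for x
   = 1, n = 3, 6 for x = 3, and n = x from 5 on; 3 and 4 for x = 1 and 6 for x = 3 fail the
   divisibility. *)
have small x : odd x -> n <= x + 4 -> x %| n -> fib n %| fib 5 * fib x ->
    n = x \/ n = 5.
  move=> x_odd + /dvdnP[u nu]; rewrite nu in n2 *.
  case: x x_odd {nu} n2 => [|[|[|[|[|x]]]]] // _ n2 le_u dvd_u.
  - have [u_eq|[u_eq|u_eq]] : u = 3 \/ u = 4 \/ u = 5 by lia.
    + by rewrite u_eq in dvd_u.
    + by rewrite u_eq in dvd_u.
    + by right; rewrite u_eq.
  - have [u_eq|u_eq] : u = 1 \/ u = 2 by lia.
      by left; rewrite u_eq.
    by rewrite u_eq in dvd_u.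
  - have u_eq : u = 1 by nia.
    by left; rewrite u_eq mul1n.
have [d1|d_neq1] := eqVneq d 1.
  case: (small e) => //; rewrite ?dvdn_gcdl ?d1 //.
  - by rewrite d1 in le_n; lia.
  - by rewrite d1 mul1n in n_de.
  - by move=> ->; constructor 2; exact: dvdn_gcdr.
  - by constructor 3.
have [e1|e_neq1] := eqVneq e 1.
  case: (small d) => //; rewrite ?dvdn_gcdl //.
  - by rewrite e1 in le_n; lia.
  - by rewrite e1 muln1 in n_de.
  - by move=> ->; constructor 1; exact: dvdn_gcdr.
  - by constructor 3.
have d2 := gt2_odd_neq1 d_odd d_neq1; have e2 := gt2_odd_neq1 e_odd e_neq1.
have de : d != e.
  by apply: contraTneq cop_de => ->; rewrite /coprime gcdnn.
exfalso; move: n2 le_n; rewrite nE; case: (t) => [|u]; first by [].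
have : d * e > d + e + 3 by case: (ltngtP d e) de => //; nia.
by nia.
Qed.

(** An index n not dividing a divides b or is 5, so F_n is coprime to F_a; one dividing a has F_n
    coprime to F_b. Hence the indices dividing a form a list to which [prod_fib_mem] applies. *)
Lemma prod_fib_mem_pair a b s : odd a -> odd b -> coprime a b -> 2 < a ->
  all (ltn 2) s -> \prod_(n <- s) fib n = 5 * (fib a * fib b) -> a \in s.
Proof.
move=> a_odd b_odd cop a2 s2 E.
pose A := [seq n <- s | n %| a].
suff: a \in A by rewrite mem_filter => /andP[].
have split_s : \prod_(n <- s) fib n
    = \prod_(n <- A) fib n * \prod_(n <- s | ~~ (n %| a)) fib n.
  by rewrite big_filter; exact: bigID.
have cop_prod (P : pred nat) c : (forall n, n \in s -> P n -> coprime c n) ->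
    coprime (fib c) (\prod_(n <- s | P n) fib n).
  move=> copP; rewrite big_seq_cond.
  apply: (big_ind (coprime (fib c))) => [|x y cx cy|n].
  - exact: coprimen1.
  - by rewrite coprimeMr cx.
  - by move=> /andP[ns Pn]; apply/coprime_fib/copP.
apply: prod_fib_mem => //.
- move=> n; rewrite mem_filter => /andP[n_a ns]; split=> //; exact: (allP s2).
- rewrite -(Gauss_dvdl _ (cop_prod (fun n => ~~ (n %| a)) a _)) -?split_s ?E.
    by rewrite mulnCA dvdn_mulr.
  move=> n ns n_a; have n2 : 2 < n := allP s2 n ns.
  have : fib n %| 5 * (fib a * fib b) by rewrite -E prod_fib_dvd.
  case/(dvdn_5fibM a_odd b_odd cop n2) => [n_a'|n_b|n5].
  + by rewrite n_a' in n_a.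
  + exact: coprime_dvdr cop.
  + by rewrite coprime_sym n5 prime_coprime // -n5.
- rewrite -(@Gauss_dvdl _ _ (fib b)).
    by rewrite -mulnA -E split_s dvdn_mulr.
  rewrite coprime_sym big_filter; apply: cop_prod => n _ n_a.
  by rewrite coprime_sym; exact: coprime_dvdl cop.
Qed.

Lemma prod_fib_rem a s : a \in s ->
  \prod_(n <- s) fib n = fib a * \prod_(n <- rem a s) fib n.
Proof. by move=> a_s; rewrite (perm_big _ (perm_to_rem a_s)) big_cons. Qed.

(** Removing m + 1 and m - 1 leaves the product F_5, so the single index 5. For m = 0 and m = 2
    there is no index m - 1 above 2; m = 4 is separate only because 5, 3, 5 has to be sorted. *)
Lemma solution_even m s : ~~ odd m -> all (ltn 2) s -> sorted leq s ->
  \prod_(n <- s) fib n = lucas m ^ 2 + 1 ->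
  s = if m == 0 then [:: 5] else if m == 2 then [:: 3; 5]
      else if m == 4 then [:: 3; 5; 5] else [:: 5; m - 1; m + 1].
Proof.
move=> m_even s2 s_sorted E.
have sorted_uniq t : sorted leq t -> perm_eq s t -> s = t.
  move=> t_sorted; exact: (sorted_eq leq_trans anti_leq).
have all_rem a t : all (ltn 2) t -> all (ltn 2) (rem a t).
  by move=> /allP t2; apply/allP => n /mem_rem /t2.
have [m0|m0] := posnP m.
  by rewrite m0 in E *; apply: (prod_fib_prime (p := 5)).
rewrite lucas_sqr_even // in E.
have a_odd : odd m.-1 by case: m m_even m0 {E} => //= m; rewrite negbK.
have b_odd : odd m.+1 by [].
have cop : coprime m.-1 m.+1.
  rewrite /coprime -dvdn1 -[m.+1](_ : 2 + m.-1 = _); last by lia.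
  by rewrite gcdnDr gcdnC -[_ %| _]/(_ %| _) dvdn1 -/(coprime 2 m.-1) coprime2n.
have b_s : m.+1 \in s.
  apply: (prod_fib_mem_pair b_odd a_odd) => //; first by rewrite coprime_sym.
    by case: m m_even m0 {s2 E a_odd b_odd cop} => [|[]].
  by rewrite E [fib m.-1 * _]mulnC.
have rem_b : \prod_(n <- rem m.+1 s) fib n = 5 * fib m.-1.
  apply/eqP; rewrite -(eqn_pmul2l (_ : 0 < fib m.+1)) ?fib_gt0 //.
  by rewrite -prod_fib_rem // E mulnA [X in _ == X]mulnC.
have perm_b := perm_to_rem b_s.
have [m2|m_neq2] := eqVneq m 2.
  rewrite m2 /= in rem_b perm_b *; apply: sorted_uniq => //.
  by rewrite (prod_fib_prime (p := 5) _ _ _ rem_b) ?all_rem in perm_b.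
have a2 : 2 < m.-1 by lia.
have a_s : m.-1 \in rem m.+1 s.
  have := prod_fib_mem_pair a_odd b_odd cop a2 s2 E.
  by rewrite (perm_mem perm_b) in_cons; case: eqP => //; lia.
have rem_ab : \prod_(n <- rem m.-1 (rem m.+1 s)) fib n = fib 5.
  apply/eqP; rewrite -(eqn_pmul2l (_ : 0 < fib m.-1)) ?fib_gt0 //; last by lia.
  by rewrite -prod_fib_rem // rem_b mulnC.
have perm_s : perm_eq s [:: m.+1; m.-1; 5].
  apply: (perm_trans perm_b); rewrite perm_cons.
  apply: (perm_trans (perm_to_rem a_s)); rewrite perm_cons.
  by rewrite (prod_fib_prime (p := 5) _ _ _ rem_ab) ?all_rem.
have [m4|m_neq4] := eqVneq m 4.
  by rewrite m4 in perm_s; apply: sorted_uniq => //; apply: perm_trans perm_s _.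
apply: sorted_uniq; first by rewrite /= andbT; lia.
rewrite subn1 addn1.
apply: (perm_trans perm_s); rewrite (perm_catC [:: m.+1; m.-1] [:: 5]) /=.
by rewrite perm_cons (perm_catC [:: _] [:: _]).
Qed.

(** * From solutions to products, and the classification *)

Lemma is_solutionE m s : is_solution m s <->
  [/\ 0 < size s, sorted leq s & \prod_(n <- s) fib n = lucas m ^ 2 + 1].
Proof.
have prodZ : (\prod_(n <- s) (fib n)%:Z = (\prod_(n <- s) fib n)%N%:Z)%R.
  by elim: s => [|n s IH]; rewrite ?big_nil // !big_cons IH PoszM.
rewrite /is_solution prodZ; split=> -[? ? E]; split=> //; last by nia.
by nia.
Qed.

(** F_1 = F_2 = 1, and a nonzero product has no index 0. This lets [solution_odd] exclude trivial
    solutions for odd m > 1 too. *)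
Lemma prod_fib_filter s : \prod_(n <- s) fib n != 0 ->
  \prod_(n <- s) fib n = \prod_(n <- [seq n <- s | 2 < n]) fib n.
Proof.
elim: s => // n s IH; rewrite big_cons muln_eq0 negb_or => /andP[n0 s0] /=.
case: ifP => n2; first by rewrite big_cons IH.
by rewrite IH //; case: n n2 n0 => [|[|[|n]]] //; rewrite mul1n.
Qed.

(** A single index satisfies F_n = L_m^2 + 1 > 1, which excludes n <= 2; otherwise sortedness
    propagates the bound on n_1. *)
Lemma nontrivial_all_gt2 m s : is_solution m s -> nontrivial s -> all (ltn 2) s.
Proof.
move=> /is_solutionE[_ s_sorted E] [size1|[_ head3]].
  case: s size1 E {s_sorted} => [|n [|]] //= _; rewrite big_seq1 andbT => E.
  have : 1 < fib n by rewrite E addn1 ltnS expn_gt0 lucas_gt0.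
  by case: n {E} => [|[|[|n]]].
case: s s_sorted head3 {E} => //= n s; rewrite (path_sortedE leq_trans).
move=> /andP[/allP n_le _] n3; rewrite n3 /=; apply/allP => k /n_le.
exact: leq_trans.
Qed.

Theorem theorem5 :
  (forall m : nat,
     (exists ns : seq nat, is_solution m ns) <-> (m = 1 \/ ~~ odd m)) /\
  (forall (m : nat) (ns : seq nat),
     (is_solution m ns /\ nontrivial ns) <->
     [\/ m = 1 /\ ns = [:: 3],
         m = 0 /\ ns = [:: 5],
         m = 2 /\ ns = [:: 3; 5]
       | m = 4 /\ ns = [:: 3; 5; 5]] \/
     [/\ ~~ odd m, 6 <= m & ns = [:: 5; m - 1; m + 1]]).
Proof.
have family m : ~~ odd m -> 6 <= m -> is_solution m [:: 5; m - 1; m + 1].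
  move=> m_even m6; apply/is_solutionE; split=> //.
    by rewrite /= andbT; lia.
  rewrite lucas_sqr_even //; last by lia.
  by rewrite !big_cons big_nil muln1 subn1 addn1.
have sol1 : is_solution 1 [:: 3].
  by apply/is_solutionE; split=> //; rewrite !big_cons big_nil.
have sol0 : is_solution 0 [:: 5].
  by apply/is_solutionE; split=> //; rewrite !big_cons big_nil.
have sol2 : is_solution 2 [:: 3; 5].
  by apply/is_solutionE; split=> //; rewrite !big_cons big_nil.
have sol4 : is_solution 4 [:: 3; 5; 5].
  by apply/is_solutionE; split=> //; rewrite !big_cons big_nil.
split=> [m|m s]; split.
- move=> [s /is_solutionE[_ _ E]].
  have prod_neq0 : \prod_(n <- s) fib n != 0 by rewrite E addn1.
  rewrite (prod_fib_filter prod_neq0) in E.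
  have [m_odd|] := boolP (odd m); last by right.
  by left; have [] := solution_odd m_odd (filter_all _ _) E.
- move=> [->|m_even]; first by exists [:: 3].
  have [m6|] := leqP 6 m; first by exists [:: 5; m - 1; m + 1]; exact: family.
  case: m m_even => [|[|[|[|[|[|m]]]]]] //= _ _;
    by [exists [:: 5]|exists [:: 3; 5]|exists [:: 3; 5; 5]].
- move=> [sol nontriv]; have s2 := nontrivial_all_gt2 sol nontriv.
  have [_ s_sorted E] := (is_solutionE m s).1 sol.
  have [m_odd|m_even] := boolP (odd m).
    by have [] := solution_odd m_odd s2 E; left; constructor 1.
  have := solution_even m_even s2 s_sorted E.
  case: eqP => [m0|m_neq0] sE; first by left; constructor 2.
  move: sE; case: eqP => [m2|m_neq2] sE; first by left; constructor 3.
  move: sE; case: eqP => [m4|m_neq4] sE; first by left; constructor 4.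
  right; split=> //; move: m_even m_neq0 m_neq2 m_neq4.
  by case: m {E sol s2 sE} => [|[|[|[|[|[|m]]]]]].
- move=> [[]|[]] => [[-> ->]|[-> ->]|[-> ->]|[-> ->]|m_even m6 ->];
    split=> //; try by [left|right].
  exact: family.
Qed.
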